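(* For every stream $s$: if $\neg\,\mathcal{G}\,(\neg\,\mathcal{G}\,\mathit{blue})\,s$, then $\neg\,\nu\mathcal{U}\,s$.
   Context: The statement is to be proved constructively (intuitionistic type theory with inductive and coinductive definitions; no excluded middle, no Markov's principle). A color is one of $R$ (red), $B$ (blue). A stream is an element of the coinductive type whose only constructor forms $c\,s$ from a color $c$ and a stream $s$; streams are considered up to bisimilarity (equivalently, functions $\mathbb{N}\to\{R,B\}$ up to pointwise equality). $\mathit{blue}\,s$ means that $s=B\,s'$ for some $s'$. For a stream predicate $X$, $\mathcal{G}\,X$ is defined coinductively by the rule: $X\,(c\,s)$ and $\mathcal{G}\,X\,s$ imply $\mathcal{G}\,X\,(c\,s)$. Negation is lifted to predicates pointwise: $\neg\,\mathcal{G}\,\mathit{blue}$ inside $\mathcal{G}(\cdot)$ is the predicate $t\mapsto\neg(\mathcal{G}\,\mathit{blue}\,t)$. For a stream predicate $X$, the strong until predicate $\mathcal{U}_X$ is defined inductively by the rules: $\mathcal{U}_X\,s$ implies $\mathcal{U}_X\,(B\,s)$; $X\,s$ implies $\mathcal{U}_X\,(R\,s)$. $\nu\mathcal{U}$ (''infinitely often red'') is the greatest fixed point of the monotone operator $X\mapsto\mathcal{U}_X$, i.e. the predicate defined coinductively by the rule: $\mathcal{U}_{\nu\mathcal{U}}\,s$ implies $\nu\mathcal{U}\,s$. *)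

(* Defs.v *)
From Stdlib Require Export Streams.

Inductive color : Set := R | B.

Definition blue (s : Stream color) : Prop := exists s', s = Cons B s'.

(* [ForAll] is stated with [tl]; at [Cons c s] its rule reads
   [X (Cons c s) -> G X s -> G X (Cons c s)]. *)
Definition G (X : Stream color -> Prop) : Stream color -> Prop := ForAll X.

Inductive U (X : Stream color -> Prop) : Stream color -> Prop :=
| U_blue s : U X s -> U X (Cons B s)
| U_red s : X s -> U X (Cons R s).

(* The greatest fixed point of [U], as the union of its post-fixed points.
   A [CoInductive] with constructor [U nuU s -> nuU s] is accepted, but the
   guard condition forbids corecursive calls under the induction on [U], so
   that [nuU_coind] would not be derivable for it by cofix. *)
Definition nuU (s : Stream color) : Prop :=
  exists X : Stream color -> Prop, (forall t, X t -> U X t) /\ X s.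

Lemma U_mono (X Y : Stream color -> Prop) :
  (forall s, X s -> Y s) -> forall s, U X s -> U Y s.
Proof. intros XY s H; induction H; constructor; auto. Qed.

Lemma nuU_coind (X : Stream color -> Prop) :
  (forall s, X s -> U X s) -> forall s, X s -> nuU s.
Proof. intros HX s Xs; exists X; split; assumption. Qed.

Lemma nuU_unfold s : nuU s -> U nuU s.
Proof.
intros [X [HX Xs]]; apply (U_mono X); [|exact (HX s Xs)].
exact (nuU_coind X HX).
Qed.

Lemma nuU_fold s : U nuU s -> nuU s.
Proof.
apply (nuU_coind (U nuU)); intros t; apply U_mono; exact nuU_unfold.
Qed.

(* Main.v *)
Require Import Defs.

(** The theorem is the contrapositive of [nuU_G_not_G_blue]. Unfolding [nuU] to [U] exhibits a red
    after finitely many blues, refuting [G blue]; as [nuU] passes to tails, it is an invariant for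
    coinduction. *)

Lemma U_not_G_blue (X : Stream color -> Prop) (s : Stream color) :
  U X s -> ~ G blue s.
Proof.
intros H; induction H as [s _ IH | s _]; intros [Hhd Htl].
- exact (IH Htl).
- destruct Hhd as [s' E]; discriminate E.
Qed.

(** Behind a blue head the tail satisfies [U nuU], which folds back to [nuU]; behind a red one it is
    in [nuU] outright. *)
Lemma nuU_tl (s : Stream color) : nuU s -> nuU (tl s).
Proof.
intros H; destruct (nuU_unfold s H) as [s' H' | s' H'].
- exact (nuU_fold s' H').
- exact H'.
Qed.

Lemma nuU_G_not_G_blue (s : Stream color) :
  nuU s -> G (fun t => ~ G blue t) s.
Proof.
revert s; cofix CIH; intros s H; constructor.
- exact (U_not_G_blue nuU s (nuU_unfold s H)).
- exact (CIH (tl s) (nuU_tl s H)).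
Qed.

Theorem lemma4p6 (s : Stream color) :
  ~ G (fun t => ~ G blue t) s -> ~ nuU s.
Proof.
intros HnG HnuU; exact (HnG (nuU_G_not_G_blue s HnuU)).
Qed.
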